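(* Let $S^1=\{x\in\mathbb{C}\mid |x|=1\}$ be the circle group. The double dualization monad on $\mathbf{Ab}$ with respect to $S^1$, i.e. the monad induced by the dual adjunction $\mathbf{Ab}(-,S^1)\dashv\mathbf{Ab}(-,S^1)\colon\mathbf{Ab}^{\mathrm{op}}\to\mathbf{Ab}$, is the codensity monad of the functor $U\colon\{S^1\times S^1\}\to\mathbf{Ab}$, where $\{S^1\times S^1\}$ is the one-object full subcategory of $\mathbf{CHAb}$ on the torus $S^1\times S^1$ and $U$ is its inclusion into $\mathbf{CHAb}$ followed by the forgetful functor $\mathbf{CHAb}\to\mathbf{Ab}$.
   Context: $\mathbf{Ab}$ is the category of abelian groups; $\mathbf{Ab}(A,S^1)$ carries the pointwise group structure. $\mathbf{CHAb}$ is the category of compact Hausdorff abelian groups and continuous group homomorphisms; $S^1$ carries the Euclidean topology inherited from $\mathbb{C}$. The codensity monad of a functor $F$ is $\mathrm{Ran}_FF$ with its canonical monad structure induced by the universal property; ''is the codensity monad'' means isomorphic as monads. *)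

(* Defs.v *)
From HB Require Import structures.
From mathcomp Require Import all_boot all_order all_algebra.
From mathcomp Require Import all_classical all_reals all_analysis.
From mathcomp Require Import complex.

Set Implicit Arguments.
Unset Strict Implicit.
Unset Printing Implicit Defensive.

Import Order.TTheory GRing.Theory Num.Theory.
Import numFieldTopology.Exports numFieldNormedType.Exports.

Local Open Scope classical_set_scope.
Local Open Scope ring_scope.

Record category := Category {
  ob :> Type;
  mor : ob -> ob -> Type;
  idc : forall a, mor a a;
  compc : forall a b c, mor b c -> mor a b -> mor a c;
  comp1c : forall a b (f : mor a b), compc (idc b) f = f;
  compc1 : forall a b (f : mor a b), compc f (idc a) = f;
  compcA : forall a b c d (h : mor c d) (g : mor b c) (f : mor a b),
    compc h (compc g f) = compc (compc h g) f }.

Arguments mor {_} _ _.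
Arguments idc {_} _.
Arguments compc {_ _ _ _} _ _.

Notation "g \c f" := (compc g f) (at level 40, left associativity).

Definition opcat (C : category) : category :=
  @Category C (fun a b => @mor C b a) (fun a => idc a)
    (fun a b c g f => f \c g)
    (fun a b f => compc1 f) (fun a b f => comp1c f)
    (fun a b c d h g f => esym (compcA f g h)).

Definition full_subcategory (C : category) (P : C -> Prop) : category :=
  @Category {a : C | P a} (fun a b => mor (sval a) (sval b))
    (fun a => idc (sval a)) (fun a b c g f => g \c f)
    (fun a b f => comp1c f) (fun a b f => compc1 f)
    (fun a b c d h g f => compcA h g f).

Record functor (C D : category) := Functor {
  fobj :> C -> D;
  fmor : forall a b, mor a b -> mor (fobj a) (fobj b);
  fmor1 : forall a, fmor (idc a) = idc (fobj a);
  fmorM : forall a b c (g : mor b c) (f : mor a b),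
    fmor (g \c f) = fmor g \c fmor f }.

Arguments fmor {_ _} _ {_ _} _.

Definition functor_id (C : category) : functor C C :=
  @Functor C C (fun a => a) (fun a b f => f)
    (fun a => erefl) (fun a b c g f => erefl).

Section functor_comp.
Variables (C D E : category) (G : functor D E) (F : functor C D).

Fact functor_comp_fmor1 a : fmor G (fmor F (idc a)) = idc (G (F a)).
Proof. by rewrite !fmor1. Qed.

Fact functor_comp_fmorM a b c (g : mor b c) (f : mor a b) :
  fmor G (fmor F (g \c f)) = fmor G (fmor F g) \c fmor G (fmor F f).
Proof. by rewrite !fmorM. Qed.

Definition functor_comp : functor C E :=
  @Functor C E (fun a => G (F a)) (fun a b f => fmor G (fmor F f))
    functor_comp_fmor1 functor_comp_fmorM.

End functor_comp.

(* The opposite of a contravariant functor, typed as [C -> opcat D] because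
   [opcat (opcat C)] is not convertible to [C]. *)
Definition functor_op (C D : category) (F : functor (opcat C) D) :
    functor C (opcat D) :=
  @Functor C (opcat D) (fun a => F a) (fun a b f => @fmor (opcat C) D F b a f)
    (fun a => @fmor1 (opcat C) D F a)
    (fun a b c g f => @fmorM (opcat C) D F c b a f g).

Definition full_inclusion (C : category) (P : C -> Prop) :
    functor (full_subcategory P) C :=
  @Functor (full_subcategory P) C (fun a => sval a) (fun a b f => f)
    (fun a => erefl) (fun a b c g f => erefl).

Record nat_trans (C D : category) (F G : functor C D) := NatTrans {
  ncomp :> forall a, mor (F a) (G a);
  natural : forall a b (f : mor a b),
    ncomp b \c fmor F f = fmor G f \c ncomp a }.

Lemma nat_transP (C D : category) (F G : functor C D) (s t : nat_trans F G) :
  (forall a, s a = t a) -> s = t.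
Proof.
case: s t => [s sN] [t tN] /= st.
have {}st : s = t by apply: functional_extensionality_dep.
by subst t; congr NatTrans; exact: Prop_irrelevance.
Qed.

Record monad (C : category) := Monad {
  monad_fun :> functor C C;
  munit : nat_trans (functor_id C) monad_fun;
  mmult : nat_trans (functor_comp monad_fun monad_fun) monad_fun;
  munitl : forall a, mmult a \c munit (monad_fun a) = idc (monad_fun a);
  munitr : forall a, mmult a \c fmor monad_fun (munit a) = idc (monad_fun a);
  mmultA : forall a,
    mmult a \c mmult (monad_fun a) = mmult a \c fmor monad_fun (mmult a) }.

Definition monad_morphism (C : category) (M N : monad C) (t : nat_trans M N) :=
  (forall a, t a \c munit M a = munit N a) /\
  (forall a, t a \c mmult M a = mmult N a \c (t (N a) \c fmor M (t a))).

Definition monads_isomorphic (C : category) (M N : monad C) :=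
  exists (s : nat_trans M N) (t : nat_trans N M),
    [/\ monad_morphism s, monad_morphism t,
        forall a, t a \c s a = idc (M a) & forall a, s a \c t a = idc (N a)].

Record adjunction (C D : category) (L : functor C D) (R : functor D C) :=
    Adjunction {
  adj_unit : nat_trans (functor_id C) (functor_comp R L);
  adj_counit : nat_trans (functor_comp L R) (functor_id D);
  adj_triangleL : forall a, adj_counit (L a) \c fmor L (adj_unit a) = idc (L a);
  adj_triangleR : forall b, fmor R (adj_counit b) \c adj_unit (R b) = idc (R b) }.

Section monad_of_adjunction.
Variables (C D : category) (L : functor C D) (R : functor D C).
Variable A : adjunction L R.

Let T := functor_comp R L.
Definition adj_mult a : mor (functor_comp T T a) (T a) :=
  fmor R (adj_counit A (L a)).

Fact adj_mult_natural a b (f : mor a b) :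
  adj_mult b \c fmor (functor_comp T T) f = fmor T f \c adj_mult a.
Proof.
rewrite /adj_mult /= -!fmorM; congr (fmor R _).
exact: (natural (adj_counit A)).
Qed.

Fact adj_mult_unitl a : adj_mult a \c adj_unit A (T a) = idc (T a).
Proof. exact: (adj_triangleR A (L a)). Qed.

Fact adj_mult_unitr a : adj_mult a \c fmor T (adj_unit A a) = idc (T a).
Proof. by rewrite /adj_mult /= -fmorM adj_triangleL fmor1. Qed.

Fact adj_multA a :
  adj_mult a \c adj_mult (T a) = adj_mult a \c fmor T (adj_mult a).
Proof.
rewrite /adj_mult /= -!fmorM; congr (fmor R _).
exact: esym (natural (adj_counit A) (adj_counit A (L a))).
Qed.

Definition monad_of_adjunction : monad C :=
  @Monad C T (adj_unit A) (NatTrans adj_mult_natural)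
    adj_mult_unitl adj_mult_unitr adj_multA.

End monad_of_adjunction.

Definition is_right_kan_extension (C D E : category) (K : functor C D)
    (F : functor C E) (Rn : functor D E) (eps : nat_trans (functor_comp Rn K) F) :=
  forall (G : functor D E) (alpha : nat_trans (functor_comp G K) F),
    exists! s : nat_trans G Rn, forall c, eps c \c s (K c) = alpha c.

Record ran (C D E : category) (K : functor C D) (F : functor C E) := Ran {
  ran_fun :> functor D E;
  ran_counit : nat_trans (functor_comp ran_fun K) F;
  ranP : is_right_kan_extension ran_counit }.

Section ran_lift.
Variables (C D E : category) (K : functor C D) (F : functor C E) (T : ran K F).
Variables (G : functor D E) (alpha : nat_trans (functor_comp G K) F).

Definition ran_lift : nat_trans G T := sval (cid (ranP T alpha)).

Lemma ran_liftE c : ran_counit T c \c ran_lift (K c) = alpha c.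
Proof. by rewrite /ran_lift; case: cid => s [? ?] /=. Qed.

End ran_lift.

Lemma ran_ext (C D E : category) (K : functor C D) (F : functor C E)
    (T : ran K F) (G : functor D E) (s t : nat_trans G T) :
  (forall c, ran_counit T c \c s (K c) = ran_counit T c \c t (K c)) -> s = t.
Proof.
move=> st.
have aN c d (f : mor c d) : (ran_counit T d \c t (K d)) \c
    fmor (functor_comp G K) f = fmor F f \c (ran_counit T c \c t (K c)).
  by rewrite -compcA (natural t (fmor K f)) !compcA (natural (ran_counit T) f).
by have [u [_ uU]] := ranP T (NatTrans aN); rewrite -(uU s)// -(uU t).
Qed.

(* The canonical monad structure: the unit corresponds under the universal
   property to the identity of [F], the multiplication to
   eps o T eps : T T F -> F. *)
Section codensity_monad.
Variables (C D : category) (F : functor C D) (T : ran F F).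

Let eps := ran_counit T.

Definition codensity_unit_transpose c :
  mor (functor_comp (functor_id D) F c) (F c) := idc (F c).

Fact codensity_unit_transpose_natural a b (f : mor a b) :
  codensity_unit_transpose b \c fmor (functor_comp (functor_id D) F) f =
  fmor F f \c codensity_unit_transpose a.
Proof. by rewrite /codensity_unit_transpose comp1c compc1. Qed.

Definition codensity_unit : nat_trans (functor_id D) T :=
  ran_lift T (NatTrans codensity_unit_transpose_natural).

Definition codensity_mult_transpose c :
    mor (functor_comp (functor_comp T T) F c) (F c) :=
  eps c \c fmor T (eps c).

Fact codensity_mult_transpose_natural a b (f : mor a b) :
  codensity_mult_transpose b \c fmor (functor_comp (functor_comp T T) F) f =
  fmor F f \c codensity_mult_transpose a.
Proof.
rewrite /codensity_mult_transpose compcA -(natural eps f) -!compcA.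
congr (_ \c _).
by rewrite /= -!fmorM (natural eps f).
Qed.

Definition codensity_mult : nat_trans (functor_comp T T) T :=
  ran_lift T (NatTrans codensity_mult_transpose_natural).

Fact codensity_unitE c : eps c \c codensity_unit (F c) = idc (F c).
Proof. exact: ran_liftE. Qed.

Fact codensity_multE c : eps c \c codensity_mult (F c) = eps c \c fmor T (eps c).
Proof. exact: ran_liftE. Qed.

Fact codensity_unitl_natural a b (f : mor a b) :
  (codensity_mult b \c codensity_unit (T b)) \c fmor T f =
  fmor T f \c (codensity_mult a \c codensity_unit (T a)).
Proof.
rewrite compcA -(natural codensity_mult f) -!compcA; congr (_ \c _).
exact: (natural codensity_unit (fmor T f)).
Qed.

Fact codensity_unitr_natural a b (f : mor a b) :
  (codensity_mult b \c fmor T (codensity_unit b)) \c fmor T f =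
  fmor T f \c (codensity_mult a \c fmor T (codensity_unit a)).
Proof.
rewrite compcA -(natural codensity_mult f) -!compcA -!fmorM; congr (_ \c _).
congr (fmor T _); exact: (natural codensity_unit f).
Qed.

Fact codensity_id_natural a b (f : mor a b) :
  idc (T b) \c fmor T f = fmor T f \c idc (T a).
Proof. by rewrite comp1c compc1. Qed.

Fact codensity_unitl a : codensity_mult a \c codensity_unit (T a) = idc (T a).
Proof.
suff /(congr1 (fun s : nat_trans T T => s a)) :
  NatTrans codensity_unitl_natural = NatTrans codensity_id_natural by [].
apply: ran_ext => c /=; rewrite -/eps compcA codensity_multE compc1 -compcA.
by rewrite -(natural codensity_unit (eps c)) /= compcA codensity_unitE comp1c.
Qed.

Fact codensity_unitr a :
  codensity_mult a \c fmor T (codensity_unit a) = idc (T a).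
Proof.
suff /(congr1 (fun s : nat_trans T T => s a)) :
  NatTrans codensity_unitr_natural = NatTrans codensity_id_natural by [].
apply: ran_ext => c /=; rewrite -/eps compcA codensity_multE compc1 -compcA.
by rewrite -fmorM codensity_unitE fmor1 compc1.
Qed.

Let T3 := functor_comp T (functor_comp T T).

Fact codensity_multAl_natural a b (f : mor a b) :
  (codensity_mult b \c codensity_mult (T b)) \c fmor T3 f =
  fmor T f \c (codensity_mult a \c codensity_mult (T a)).
Proof.
rewrite compcA -(natural codensity_mult f) -!compcA; congr (_ \c _).
exact: (natural codensity_mult (fmor T f)).
Qed.

Fact codensity_multAr_natural a b (f : mor a b) :
  (codensity_mult b \c fmor T (codensity_mult b)) \c fmor T3 f =
  fmor T f \c (codensity_mult a \c fmor T (codensity_mult a)).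
Proof.
rewrite compcA -(natural codensity_mult f) -!compcA; congr (_ \c _).
by rewrite /= -!fmorM -(natural codensity_mult f).
Qed.

Fact codensity_multA a : codensity_mult a \c codensity_mult (T a) =
  codensity_mult a \c fmor T (codensity_mult a).
Proof.
suff /(congr1 (fun s : nat_trans T3 T => s a)) :
  NatTrans codensity_multAl_natural = NatTrans codensity_multAr_natural by [].
apply: ran_ext => c /=; rewrite -/eps !compcA codensity_multE -!compcA.
rewrite -(natural codensity_mult (eps c)) /= compcA codensity_multE.
by rewrite -!compcA -!fmorM codensity_multE.
Qed.

Definition codensity_monad : monad D :=
  @Monad D T codensity_unit codensity_mult
    codensity_unitl codensity_unitr codensity_multA.

End codensity_monad.

Definition is_codensity_monad (C D : category) (M : monad D) (F : functor C D) :=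
  exists T : ran F F, monads_isomorphic M (codensity_monad T).

Lemma additiveP (A B : zmodType) (f g : {additive A -> B}) : f =1 g -> f = g.
Proof.
case: f g => [f [[fP]]] [g [[gP]]] /= /funext fg; subst g.
by rewrite (Prop_irrelevance fP gP).
Qed.

Definition Ab_comp (A B C : zmodType) (g : {additive B -> C})
    (f : {additive A -> B}) : {additive A -> C} := g \o f.

(* Classically every abelian group carries the choice structure bundled in
   [zmodType]. *)
Definition Ab : category :=
  @Category zmodType (fun A B => {additive A -> B})
    (fun A => idfun : {additive A -> A}) Ab_comp
    (fun A B f => @additiveP A B (Ab_comp idfun f) f (fun x => erefl))
    (fun A B f => @additiveP A B (Ab_comp f idfun) f (fun x => erefl))
    (fun A B C D h g f => @additiveP A D
      (Ab_comp h (Ab_comp g f)) (Ab_comp (Ab_comp h g) f) (fun x => erefl)).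

(* The group Ab(A, B) under pointwise operations. *)
Definition Ab_hom (A B : zmodType) : Type := {additive A -> B}.

Section Ab_hom.
Variables A B : zmodType.

HB.instance Definition _ := gen_eqMixin (Ab_hom A B).
HB.instance Definition _ := gen_choiceMixin (Ab_hom A B).

Implicit Types f g h : Ab_hom A B.

Definition Ab_hom0 : Ab_hom A B := \0 : {additive A -> B}.
Definition Ab_hom_opp f : Ab_hom A B := (\- f : A -> B) : {additive A -> B}.
Definition Ab_hom_add f g : Ab_hom A B := (f \+ g : A -> B) : {additive A -> B}.

Fact Ab_hom_addA : associative Ab_hom_add.
Proof. by move=> f g h; apply: additiveP => x; exact: addrA. Qed.
Fact Ab_hom_addC : commutative Ab_hom_add.
Proof. by move=> f g; apply: additiveP => x; exact: addrC. Qed.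
Fact Ab_hom_add0 : left_id Ab_hom0 Ab_hom_add.
Proof. by move=> f; apply: additiveP => x; exact: add0r. Qed.
Fact Ab_hom_addN : left_inverse Ab_hom0 Ab_hom_opp Ab_hom_add.
Proof. by move=> f; apply: additiveP => x; exact: addNr. Qed.

HB.instance Definition _ :=
  GRing.isZmodule.Build (Ab_hom A B)
    Ab_hom_addA Ab_hom_addC Ab_hom_add0 Ab_hom_addN.

End Ab_hom.

Section Ab_dual.
Variable K : zmodType.

Section precomp.
Variables (A B : zmodType) (f : {additive A -> B}).

Definition Ab_precomp (h : Ab_hom B K) : Ab_hom A K :=
  ((h : {additive B -> K}) \o f : A -> K) : {additive A -> K}.

Fact Ab_precomp_is_zmod_morphism : zmod_morphism Ab_precomp.
Proof. by move=> g h; apply: additiveP. Qed.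

HB.instance Definition _ :=
  GRing.isZmodMorphism.Build (Ab_hom B K) (Ab_hom A K) Ab_precomp
    Ab_precomp_is_zmod_morphism.

End precomp.

Fact Ab_precomp1 (A : zmodType) :
  (Ab_precomp (idfun : {additive A -> A}) : {additive _ -> _}) =
  (idfun : {additive Ab_hom A K -> Ab_hom A K}).
Proof. by apply: additiveP => h; apply: additiveP. Qed.

Fact Ab_precompM (A B C : zmodType) (g : {additive A -> B})
    (f : {additive B -> C}) :
  (Ab_precomp (Ab_comp f g) : {additive _ -> _}) =
  Ab_comp (Ab_precomp g : {additive _ -> _}) (Ab_precomp f : {additive _ -> _}).
Proof. by apply: additiveP => h; apply: additiveP. Qed.

(* The contravariant hom functor Ab(-, K). *)
Definition Ab_dual : functor (opcat Ab) Ab :=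
  @Functor (opcat Ab) Ab (fun A => Ab_hom A K : zmodType)
    (fun A B f => Ab_precomp f : {additive Ab_hom A K -> Ab_hom B K})
    (fun A => Ab_precomp1 A) (fun A B C g f => Ab_precompM g f).

Section eval.
Variable A : zmodType.

Section eval_at.
Variable x : A.

Definition Ab_eval_at (h : Ab_hom A K) : K := (h : {additive A -> K}) x.

Fact Ab_eval_at_is_zmod_morphism : zmod_morphism Ab_eval_at.
Proof. by []. Qed.

HB.instance Definition _ :=
  GRing.isZmodMorphism.Build (Ab_hom A K) K Ab_eval_at
    Ab_eval_at_is_zmod_morphism.

End eval_at.

Definition Ab_eval (x : A) : Ab_hom (Ab_hom A K) K :=
  Ab_eval_at x : {additive Ab_hom A K -> K}.

Fact Ab_eval_is_zmod_morphism : zmod_morphism Ab_eval.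
Proof. by move=> x y; apply: additiveP => h; exact: raddfB. Qed.

HB.instance Definition _ :=
  GRing.isZmodMorphism.Build A (Ab_hom (Ab_hom A K) K) Ab_eval
    Ab_eval_is_zmod_morphism.

End eval.

Arguments Ab_eval : clear implicits.

Fact Ab_eval_natural (A B : zmodType) (f : {additive A -> B}) :
  Ab_comp (Ab_eval B : {additive _ -> _}) f =
  Ab_comp (Ab_precomp (Ab_precomp f : {additive _ -> _}) : {additive _ -> _})
    (Ab_eval A : {additive _ -> _}).
Proof. by apply: additiveP => x; apply: additiveP. Qed.

(* Unit and counit are both given by evaluation; the counit is a
   transformation in the opposite category. *)
Definition Ab_dual_unit :
    nat_trans (functor_id Ab) (functor_comp Ab_dual (functor_op Ab_dual)) :=
  @NatTrans _ _ (functor_id Ab) (functor_comp Ab_dual (functor_op Ab_dual))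
    (fun A : zmodType => Ab_eval A : {additive _ -> _}) Ab_eval_natural.

Definition Ab_dual_counit :
    nat_trans (functor_comp (functor_op Ab_dual) Ab_dual) (functor_id (opcat Ab)) :=
  @NatTrans _ _ (functor_comp (functor_op Ab_dual) Ab_dual) (functor_id (opcat Ab))
    (fun A : zmodType => Ab_eval A : {additive _ -> _})
    (fun A B f => esym (Ab_eval_natural f)).

Fact Ab_dual_triangle (A : zmodType) :
  Ab_comp (Ab_precomp (Ab_eval A : {additive _ -> _}) : {additive _ -> _})
    (Ab_eval (Ab_hom A K) : {additive _ -> _}) =
  (idfun : {additive Ab_hom A K -> Ab_hom A K}).
Proof. by apply: additiveP => h; apply: additiveP. Qed.

Definition Ab_dual_adjunction : adjunction (functor_op Ab_dual) Ab_dual :=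
  @Adjunction _ _ (functor_op Ab_dual) Ab_dual Ab_dual_unit Ab_dual_counit
    Ab_dual_triangle Ab_dual_triangle.

Definition double_dualization_monad : monad Ab :=
  monad_of_adjunction Ab_dual_adjunction.

End Ab_dual.

Record chab := CHAbGroup {
  chab_group :> topologicalZmodType;
  chab_compact : compact [set: chab_group];
  chab_hausdorff : hausdorff_space chab_group }.

Record chab_hom (A B : chab) := CHAbHom {
  chab_fun :> {additive A -> B};
  chab_continuous : continuous chab_fun }.

Lemma chab_homP (A B : chab) (f g : chab_hom A B) : f =1 g -> f = g.
Proof.
case: f g => [f fc] [g gc] /= /additiveP fg; subst g.
by rewrite (Prop_irrelevance fc gc).
Qed.

Definition chab_id (A : chab) : chab_hom A A :=
  @CHAbHom A A (idfun : {additive A -> A}) (fun x => cvg_id).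

Fact chab_comp_continuous (A B C : chab) (g : chab_hom B C) (f : chab_hom A B) :
  continuous (g \o f).
Proof.
by move=> x; apply: continuous_comp; exact: (@chab_continuous).
Qed.

Definition chab_comp (A B C : chab) (g : chab_hom B C) (f : chab_hom A B) :
    chab_hom A C :=
  @CHAbHom A C ((g \o f : A -> C) : {additive A -> C})
    (@chab_comp_continuous A B C g f).

Definition CHAb : category :=
  @Category chab chab_hom chab_id chab_comp
    (fun A B f => @chab_homP A B (chab_comp (chab_id B) f) f (fun x => erefl))
    (fun A B f => @chab_homP A B (chab_comp f (chab_id A)) f (fun x => erefl))
    (fun A B C D h g f => @chab_homP A D (chab_comp h (chab_comp g f))
      (chab_comp (chab_comp h g) f) (fun x => erefl)).

Definition CHAb_forget : functor CHAb Ab :=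
  @Functor CHAb Ab (fun A : chab => (A : zmodType))
    (fun A B (f : chab_hom A B) => (f : {additive A -> B}))
    (fun A : chab => @additiveP A A (chab_id A) idfun (fun x => erefl))
    (fun (A B C : chab) (g : chab_hom B C) (f : chab_hom A B) =>
      @additiveP A C (chab_comp g f) (Ab_comp g f) (fun x => erefl)).

(* The topology of [C] comes from its [numFieldType] structure and is not
   inferred on [R[i]] itself. *)
Definition complexF (R : realType) : numFieldType := R[i].

Definition unit_circle (R : realType) : set (complexF R) := [set z | `|z| = 1].
Arguments unit_circle : clear implicits.

(* [set_type] carries the subset topology. *)
Definition S1 (R : realType) : Type := set_type (unit_circle R).

Section S1.
Variable R : realType.

HB.instance Definition _ := Topological.on (S1 R).

Definition S1_val (z : S1 R) : complexF R := set_val z.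

Lemma S1_norm (z : S1 R) : `|S1_val z| = 1.
Proof. exact: (set_mem (valP z)). Qed.

Lemma S1_neq0 (z : S1 R) : S1_val z != 0.
Proof. by rewrite -normr_eq0 S1_norm oner_eq0. Qed.

Lemma S1_val_inj : injective S1_val.
Proof. exact: val_inj. Qed.

Definition S1_sub (z : complexF R) (z1 : `|z| = 1) : S1 R :=
  exist _ z (mem_set z1).

Fact S1_norm1 : `|1 : complexF R| = 1.
Proof. exact: normr1. Qed.
Fact S1_normV (z : S1 R) : `|(S1_val z)^-1| = 1.
Proof. by rewrite normfV S1_norm invr1. Qed.
Fact S1_normM (z w : S1 R) : `|S1_val z * S1_val w| = 1.
Proof. by rewrite normrM !S1_norm mulr1. Qed.

(* The abelian group structure is complex multiplication, in additive notation. *)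
Definition S1_zero : S1 R := S1_sub S1_norm1.
Definition S1_opp (z : S1 R) : S1 R := S1_sub (S1_normV z).
Definition S1_add (z w : S1 R) : S1 R := S1_sub (S1_normM z w).

Fact S1_addA : associative S1_add.
Proof. by move=> x y z; apply: S1_val_inj; exact: mulrA. Qed.
Fact S1_addC : commutative S1_add.
Proof. by move=> x y; apply: S1_val_inj; exact: mulrC. Qed.
Fact S1_add0 : left_id S1_zero S1_add.
Proof. by move=> x; apply: S1_val_inj; exact: mul1r. Qed.
Fact S1_addN : left_inverse S1_zero S1_opp S1_add.
Proof. by move=> x; apply: S1_val_inj; exact: (mulVf (S1_neq0 x)). Qed.

HB.instance Definition _ :=
  GRing.isZmodule.Build (S1 R) S1_addA S1_addC S1_add0 S1_addN.

Lemma S1_val_continuous : continuous S1_val.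
Proof. exact: initial_continuous. Qed.

Fact S1_add_continuous : continuous (fun x : S1 R * S1 R => x.1 + x.2).
Proof.
apply: (@continuous_comp_initial _ _ _ set_val) => x.
apply: (@cvgM _ _ _ _ (fun x => S1_val x.1) (fun x => S1_val x.2)).
  by apply: continuous_comp; [exact: cvg_fst | exact: S1_val_continuous].
by apply: continuous_comp; [exact: cvg_snd | exact: S1_val_continuous].
Qed.

HB.instance Definition _ :=
  PreTopologicalNmodule_isTopologicalNmodule.Build (S1 R) S1_add_continuous.

Fact S1_opp_continuous : continuous (-%R : S1 R -> S1 R).
Proof.
apply: (@continuous_comp_initial _ _ _ set_val) => x.
exact: (cvgV (S1_neq0 x) (@S1_val_continuous x)).
Qed.

HB.instance Definition _ :=
  TopologicalNmodule_isTopologicalZmodule.Build (S1 R) S1_opp_continuous.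

Lemma S1_hausdorff : hausdorff_space (S1 R).
Proof.
move=> p q pq; apply: S1_val_inj; apply: (@norm_hausdorff (complexF R)).
move=> A B /(@S1_val_continuous p) pA /(@S1_val_continuous q) qB.
by have [z [zA zB]] := pq _ _ pA qB; exists (S1_val z).
Qed.

Fact Complex_continuous :
  continuous (fun p : R * R => Complex p.1 p.2 : complexF R).
Proof.
move=> [a b]; apply/(@cvgrPdist_lt _ (complexF R)) => -[e e'].
rewrite ltcE /= => /andP[/eqP -> e0].
have e2 : 0 < e / 2 by rewrite divr_gt0.
have : fst @ nbhs ((a, b) : R * R) --> a by exact: cvg_fst.
move=> /cvgrPdist_lt /(_ _ e2) ae.
have : snd @ nbhs ((a, b) : R * R) --> b by exact: cvg_snd.
move=> /cvgrPdist_lt /(_ _ e2) be.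
near=> p.
have -> : Complex a b - Complex p.1 p.2 =
    Complex (a - p.1) 0 + Complex 0 (b - p.2) :> complexF R.
  by apply/eqP; rewrite eq_complex /= addr0 add0r !eqxx.
apply: le_lt_trans (ler_normD _ _) _.
rewrite !normc_def /= !expr0n /= addr0 add0r !sqrtr_sqr.
rewrite ltcE /= !addr0 eqxx [e]splitr /=.
by apply: ltrD; near: p.
Unshelve. all: by end_near. Qed.

Fact S1_cis_norm (t : R) : `|Complex (cos t) (sin t) : complexF R| = 1.
Proof. by rewrite normc_def /= cos2Dsin2 sqrtr1. Qed.

Lemma S1_compact : compact [set: S1 R].
Proof.
pose cis t := S1_sub (S1_cis_norm t).
suff -> : [set: S1 R] = cis @` `[- pi, pi].
  apply: continuous_compact; last exact: segment_compact.
  apply: continuous_subspaceT; apply: (@continuous_comp_initial _ _ _ set_val).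
  move=> t.
  apply: (@continuous_comp _ _ _ (fun t => (cos t, sin t))
    (fun p : R * R => Complex p.1 p.2 : complexF R)).
    by apply: (@cvg_pair _ _ _ (nbhs t) (nbhs (cos t)) (nbhs (sin t)));
      [exact: continuous_cos | exact: continuous_sin].
  exact: Complex_continuous.
apply/seteqP; split=> // z _.
have := S1_norm z; case zE : (S1_val z) => [x y].
rewrite normc_def /= => /eqP; rewrite eq_complex /= eqxx andbT => /eqP xy1.
have {}xy1 : x ^+ 2 + y ^+ 2 = 1.
  by rewrite -(@sqr_sqrtr _ (_ + _)) ?addr_ge0 ?sqr_ge0// xy1 expr1n.
have xI : -1 <= x <= 1.
  rewrite -ler_norml -ler_sqr ?nnegrE// expr1n real_normK ?num_real//.
  by rewrite -xy1 lerDl sqr_ge0.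
have sinE : sin (acos x) = `|y|.
  by rewrite sin_acos// -xy1 addrAC subrr add0r sqrtr_sqr.
have cisE t : S1_val (cis t) = Complex (cos t) (sin t) by [].
have [y0|y0] := leP 0 y.
  exists (acos x).
    rewrite /= in_itv /= acos_lepi// andbT.
    by rewrite (le_trans _ (acos_ge0 _))// oppr_le0 pi_ge0.
  by apply: S1_val_inj; rewrite zE cisE acosK ?in_itv// sinE ger0_norm.
exists (- acos x).
  rewrite /= in_itv /= lerN2 acos_lepi//=.
  by rewrite (le_trans _ (pi_ge0 _))// oppr_le0 acos_ge0.
by apply: S1_val_inj; rewrite zE cisE cosN sinN acosK ?in_itv// sinE ltr0_norm//
  opprK.
Qed.

End S1.

(* An alias, since the library makes [G * H] a topological group only for
   modules [G] and [H]; the group structure and the topology are the library's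
   ones on products. *)
Definition S1xS1 (R : realType) : Type := (S1 R * S1 R)%type.

Section torus.
Variable R : realType.

HB.instance Definition _ := GRing.Zmodule.copy (S1xS1 R) (S1 R * S1 R)%type.
HB.instance Definition _ := Topological.copy (S1xS1 R) (S1 R * S1 R)%type.

Fact torus_sub_continuous :
  continuous (fun x : S1xS1 R * S1xS1 R => x.1 - x.2).
Proof.
have fstC : continuous (fst : S1xS1 R -> S1 R).
  by move=> x; exact: (@cvg_fst _ _ (nbhs x.1) (nbhs x.2)).
have sndC : continuous (snd : S1xS1 R -> S1 R).
  by move=> x; exact: (@cvg_snd _ _ (nbhs x.1) (nbhs x.2)).
have pC (p : S1xS1 R -> S1 R) : continuous p ->
    continuous (fun x : S1xS1 R * S1xS1 R => p x.1 - p x.2).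
  move=> pc x; apply: (@continuous_comp _ _ _
    (fun x : S1xS1 R * S1xS1 R => (p x.1, p x.2))
    (fun x : S1 R * S1 R => x.1 - x.2)); last exact: sub_continuous.
  apply: (@cvg_pair _ _ _ (nbhs x) (nbhs (p x.1)) (nbhs (p x.2))).
    by apply: continuous_comp; [exact: cvg_fst | exact: pc].
  by apply: continuous_comp; [exact: cvg_snd | exact: pc].
move=> x.
exact: (@cvg_pair _ _ _ (nbhs x) _ _ _ _ _ _ _ (pC _ fstC x) (pC _ sndC x)).
Qed.

HB.instance Definition _ :=
  PreTopologicalNmodule_isTopologicalZmodule.Build (S1xS1 R)
    torus_sub_continuous.

Fact torus_compact : compact [set: S1xS1 R].
Proof. by rewrite -setXTT; apply: compact_setX; exact: S1_compact. Qed.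

Fact torus_hausdorff : hausdorff_space (S1xS1 R).
Proof.
move=> p q pq; have fst_eq : p.1 = q.1.
  apply: S1_hausdorff => A B /(@cvg_fst _ _ _ (nbhs p.2) _) pA.
  move=> /(@cvg_fst _ _ _ (nbhs q.2) _) qB.
  have [z [zA zB]] := pq (fst @^-1` A) (fst @^-1` B) pA qB.
  by exists z.1.
have snd_eq : p.2 = q.2.
  apply: S1_hausdorff => A B /(@cvg_snd _ _ (nbhs p.1) _ _) pA.
  move=> /(@cvg_snd _ _ (nbhs q.1) _ _) qB.
  have [z [zA zB]] := pq (snd @^-1` A) (snd @^-1` B) pA qB.
  by exists z.2.
by case: p q fst_eq snd_eq {pq} => [p1 p2] [q1 q2] /= -> ->.
Qed.

Definition torus : CHAb :=
  @CHAbGroup (S1xS1 R) torus_compact torus_hausdorff.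

Definition torus_category : category :=
  @full_subcategory CHAb (fun A => A = torus).

Definition torus_forget : functor torus_category Ab :=
  functor_comp CHAb_forget (@full_inclusion CHAb (fun A => A = torus)).

End torus.

(* Main.v *)
(** A natural transformation [G o U -> U] is a map [alpha : G (T) -> T] on the
torus [T = S^1 x S^1] commuting with the continuous endomorphisms of [T].  It
lifts to [x |-> (f |-> pr_1 (alpha (G <f, 0> x)))] in the double dual, and
additivity in [f] is where the square of the circle is needed: it expresses
equivariance under [(x, y) |-> (x - y, 0)].  That the evaluation
[psi |-> (psi pr_1, psi pr_2)] is itself equivariant, hence a counit, holds
because the continuous endomorphisms of [T] are integer matrices, i.e. those of
the circle are the maps [z |-> z^k].  Such a map is determined by its pullback
to the real line, a continuous homomorphism, which is found by repeated halving
near 0 and density of the dyadic multiples. *)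

Require Import Defs.
From HB Require Import structures.
From mathcomp Require Import all_boot all_order all_algebra.
From mathcomp Require Import all_classical all_reals all_analysis.
From mathcomp Require Import complex lra.

Set Implicit Arguments.
Unset Strict Implicit.
Unset Printing Implicit Defensive.

Import Order.TTheory GRing.Theory Num.Theory.
Import numFieldTopology.Exports numFieldNormedType.Exports.

Local Open Scope classical_set_scope.
Local Open Scope ring_scope.

(** * The covering of the circle by the line, and the continuous endomorphisms of the circle *)

Section circle.
Variable R : realType.
Implicit Types (s t c : R) (z w : S1 R).

Definition cis t : S1 R := S1_sub (S1_cis_norm t).

Lemma cisE t : S1_val (cis t) = Complex (cos t) (sin t).
Proof. by []. Qed.

Fact cis_is_zmod_morphism : zmod_morphism cis.
Proof.
have cisD s t : cis (s + t) = cis s + cis t.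
  apply: S1_val_inj; rewrite cisE cosD sinD.
  by apply/eqP; rewrite eq_complex /= eqxx addrC eqxx.
by move=> s t; apply/esym/eqP; rewrite subr_eq -cisD subrK.
Qed.

HB.instance Definition _ :=
  GRing.isZmodMorphism.Build R (S1 R) cis cis_is_zmod_morphism.

Lemma cis_continuous : continuous cis.
Proof.
apply: (@continuous_comp_initial _ _ _ set_val) => t.
apply: (@continuous_comp _ _ _ (fun t => (cos t, sin t))
  (fun p : R * R => Complex p.1 p.2 : complexF R)).
  by apply: (@cvg_pair _ _ _ (nbhs t) (nbhs (cos t)) (nbhs (sin t)));
    [exact: continuous_cos | exact: continuous_sin].
exact: Complex_continuous.
Qed.

Definition S1_re z : R := complex.Re (S1_val z).

Lemma S1_re_sqr z : S1_re z ^+ 2 + complex.Im (S1_val z) ^+ 2 = 1.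
Proof.
have := S1_norm z; rewrite /S1_re; case: (S1_val z) => x y.
rewrite normc_def /= => -[xy1].
by rewrite -(@sqr_sqrtr _ (_ + _)) ?addr_ge0 ?sqr_ge0// xy1 expr1n.
Qed.

Lemma cis_surj z : exists2 t, `|t| <= pi & cis t = z.
Proof.
(* Inversion on the circle flips the sign of the imaginary part and of the angle, so the upper half
   suffices; there [acos] gives the angle. *)
wlog y0 : z / 0 <= complex.Im (S1_val z).
  move=> H; have [/H//|y0] := leP 0 (complex.Im (S1_val z)).
  have [t tpi tz] : exists2 t, `|t| <= pi & cis t = - z.
    apply: H; have -> : S1_val (- z) = (S1_val z)^-1 by [].
    move: y0; case: (S1_val z) => x y /= y0.
    by rewrite oppr_ge0 mulr_le0_ge0 ?(ltW y0)// invr_ge0 addr_ge0 ?sqr_ge0.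
  by exists (- t); rewrite ?normrN// raddfN /= tz opprK.
have xy1 := S1_re_sqr z; have xI : -1 <= S1_re z <= 1.
  rewrite -ler_norml -ler_sqr ?nnegrE// expr1n real_normK ?num_real//.
  by rewrite -xy1 lerDl sqr_ge0.
exists (acos (S1_re z)); first by rewrite ger0_norm ?acos_ge0 ?acos_lepi.
apply: S1_val_inj; rewrite cisE acosK ?in_itv// sin_acos//.
rewrite -xy1 addrAC subrr add0r sqrtr_sqr ger0_norm// /S1_re.
by case: (S1_val z).
Qed.

(** The bound [pi / 2] keeps all halvings of the angle in the right half-plane. *)
Lemma cis_re_gt0 z : 0 < S1_re z -> exists2 t, `|t| < pi / 2 & cis t = z.
Proof.
have [t tpi <-] := cis_surj z; rewrite /S1_re cisE /= => t0.
exists t => //; rewrite ltNge; apply/negP => pit.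
suff : cos t <= 0 by rewrite leNgt t0.
have -> : cos t = cos `|t|.
  by have [|] := ger0P t; rewrite ?cosN.
(* If the absolute value of [t] lies between [pi / 2] and [pi], its supplement has nonnegative
   cosine. *)
have := @cos_ge0_pihalf _ (pi - `|t|).
rewrite cosB cospi sinpi mul0r addr0 mulN1r oppr_ge0; apply.
by apply/andP; split; have := pi_ge0 R; lra.
Qed.

(** Two square roots of the same number differ at most by a sign, and only one sign gives a positive
    real part. Halving is thus unambiguous near the neutral element. *)
Lemma S1_double_inj z w :
  0 < S1_re z -> 0 < S1_re w -> z + z = w + w -> z = w.
Proof.
rewrite /S1_re => z0 w0 /(congr1 (@S1_val R)) zw.
have /eqP : S1_val z ^+ 2 = S1_val w ^+ 2 by rewrite !expr2; exact: zw.
rewrite eqf_sqr => /orP[/eqP/S1_val_inj//|/eqP zNw].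
move: z0 w0; rewrite zNw; case: (S1_val w) => x y /=.
by rewrite oppr_gt0 => /ltW; rewrite leNgt => /negbTE ->.
Qed.

Lemma S1_re_gt0_nbhs : nbhs (0 : S1 R) [set z | 0 < S1_re z].
Proof.
(* The open disc of radius 1 around 1 lies in the right half-plane. *)
have /cvgrPdist_lt /(_ 1 ltr01) := @S1_val_continuous R 0.
apply: filterS => z /=.
have -> : S1_val (0 : S1 R) = 1 by [].
move=> /(le_lt_trans (normc_ge_Re _)).
rewrite /S1_re; case: (S1_val z) => x y /=.
rewrite ltcR => /(le_lt_trans (ler_norm _)); lra.
Qed.

Lemma cis_eq0 t : cis t = 0 -> exists k : int, t = pi *+ 2 *~ k.
Proof.
move=> t0; have pi2 : 0 < pi *+ 2 :> R by rewrite pmulrn_lgt0// pi_gt0.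
pose k := Num.floor (t / (pi *+ 2)); exists k.
(* The remainder lies in [[0, 2 pi)] and has cosine 1, so [sin (r / 2) = 0]. As the sine is positive
   inside [(0, pi)], this forces [r = 0]. *)
pose r := t - pi *+ 2 *~ k.
have r0 : 0 <= r.
  by rewrite subr_ge0 -mulrzl -ler_pdivlMr// ge_floor ?num_real.
have rpi : r < pi *+ 2.
  rewrite ltrBlDr -[X in X + _]mulr1z -mulrzDr -mulrzl -ltr_pdivrMr//.
  by rewrite addrC floorD1_gt ?num_real.
have cisr : cis r = 0.
  rewrite raddfB raddfMz /= t0.
  suff -> : cis (pi *+ 2) = 0 by rewrite mul0rz subr0.
  by apply: S1_val_inj; rewrite cisE cos2pi sin_mulr2n sinpi mulr0 mul0rn.
have : cos r = 1 by move/(congr1 S1_re): cisr.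
have -> : r = (r / 2) *+ 2 by rewrite -mulr_natr divfK.
rewrite cos_mulr2n cos2sin2 => sr.
have {}sr : sin (r / 2) = 0 by apply/eqP; rewrite -sqrf_eq0; apply/eqP; lra.
move: r0; rewrite le_eqVlt => /predU1P[/esym/eqP|r_gt0].
  by rewrite subr_eq0 => /eqP.
have := @sin_gt0_pi _ (r / 2); rewrite sr ltxx => H; suff: false by []; apply: H.
by rewrite divr_gt0//= ltr_pdivrMr// mulr_natr.
Qed.

Lemma dyadic_vanish (f : {additive R -> S1 R}) d : 0 < d -> continuous f ->
  (forall n, f (d / 2 ^+ n) = 0) -> f = \0 :> (R -> S1 R).
Proof.
move=> d0 fc fd; apply/funext => t.
pose e n := d / 2 ^+ n; have e0 n : 0 < e n by rewrite divr_gt0 ?exprn_gt0.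
(* Subtracting a multiple of [e n] leaves the value of [f] unchanged, while the remainder tends to
   0. Hence the constant [f t] converges to [f 0]. *)
pose r n := t - e n *~ Num.floor (t / e n).
have fr n : f (r n) = f t by rewrite raddfB raddfMz /= fd mul0rz subr0.
have r0 : r @ \oo --> 0.
  apply: (@squeeze_cvgr _ _ _ _ (fun=> 0) e); last 2 first.
  - exact: cvg_cst.
  - have := @cvg_geometric R d 2^-1; rewrite /geometric /=.
    under eq_fun do rewrite exprVn; apply.
    by rewrite ger0_norm ?invf_lt1 ?ltr1n.
  apply: nearW => n.
  rewrite subr_ge0 -mulrzl -ler_pdivlMr// ge_floor ?num_real//=.
  rewrite lerBlDr -[X in X + _]mulr1z -mulrzDr -mulrzl -ler_pdivrMr//.
  by rewrite addrC ltW// floorD1_gt ?num_real.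
have : f \o r @ \oo --> f 0 by apply: continuous_cvg => //; exact: fc.
rewrite raddf0.
have -> : f \o r = cst (f t) by apply/funext => n; exact: fr.
by move/(cvg_unique (@S1_hausdorff R) (@cvg_cst _ (f t) _ _ _)).
Qed.

(** Write [f d = cis h] for a small [d]. Unique halving fixes [f] at all [d / 2 ^+ n], and the slope
    is [h / d]. *)
Lemma continuous_character_real (f : {additive R -> S1 R}) : continuous f ->
  exists c, forall t, f t = cis (c * t).
Proof.
move=> fc.
have [d /= d0 fd] :
    exists2 d : R, 0 < d & forall t, `|t| <= d -> 0 < S1_re (f t).
  have : nbhs (f 0) [set z | 0 < S1_re z].
    by rewrite raddf0; exact: S1_re_gt0_nbhs.
  move=> /fc /nbhs_ballP[d /= d0 df]; exists (d / 2); first by rewrite divr_gt0.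
  move=> t td; apply: df; rewrite /ball /= sub0r normrN.
  by rewrite (le_lt_trans td)// ltr_pdivrMr// ltr_pMr// ltr1n.
have dd : `|d| <= d by rewrite gtr0_norm.
have [h hpi fdh] := cis_re_gt0 (fd d dd).
have half n : f (d / 2 ^+ n) = cis (h / 2 ^+ n).
  elim: n => [|n IHn]; first by rewrite !divr1.
  have n1 : (2 ^+ n.+1)^-1 <= 1 :> R.
    by rewrite invf_le1 ?exprn_gt0// exprn_ege1// ler1n.
  have n0 : 0 <= (2 ^+ n.+1)^-1 :> R by rewrite invr_ge0 exprn_ge0.
  (* Both sides have positive real part and double to the value at stage [n]. *)
  apply: S1_double_inj.
  - by apply: fd; rewrite normrM (ger0_norm n0) gtr0_norm// ler_piMr// ltW.
  - rewrite /S1_re cisE /=; apply: cos_gt0_pihalf.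
    rewrite -ltr_norml normrM (ger0_norm n0) (le_lt_trans _ hpi)//.
    by rewrite ler_piMr.
  - have H x : x / 2 ^+ n.+1 + x / 2 ^+ n.+1 = x / 2 ^+ n :> R.
      by rewrite exprS invfM mulrCA [x / _]mulrC; lra.
    by rewrite -!raddfD !H.
exists (h / d).
have gP : zmod_morphism (fun t => f t - cis (h / d * t)).
  by move=> s t; rewrite mulrBr (raddfB f) (raddfB cis) /= !opprD addrACA.
pose gA := GRing.isZmodMorphism.Build R (S1 R) _ gP.
(* The discrepancy between [f] and the candidate is a continuous character that vanishes at all
   [d / 2 ^+ n]. *)
pose g : {additive R -> S1 R} := HB.pack (fun t => f t - cis (h / d * t)) gA.
have gc : continuous g.
  move=> t; apply: (@continuous_comp _ _ _ (fun t => (f t, cis (h / d * t)))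
    (fun p : S1 R * S1 R => p.1 - p.2)); last exact: sub_continuous.
  apply: (@cvg_pair _ _ _ (nbhs t) (nbhs (f t)) (nbhs (cis (h / d * t)))).
    exact: fc.
  apply: (@continuous_comp _ _ _ (fun t => h / d * t) cis).
    exact: mulrl_continuous.
  exact: cis_continuous.
have gd n : g (d / 2 ^+ n) = 0.
  by rewrite /= half mulrA divfK ?gt_eqF// subrr.
move=> t; have /(congr1 (@^~ t))/eqP := dyadic_vanish d0 gc gd.
by rewrite /= subr_eq0 => /eqP.
Qed.

Lemma continuous_S1_endo (f : {additive S1 R -> S1 R}) : continuous f ->
  exists k : int, forall z, f z = z *~ k.
Proof.
move=> fc.
have [|c cE] := @continuous_character_real (f \o cis : {additive R -> S1 R}).
  by move=> t; apply: continuous_comp; [exact: cis_continuous | exact: fc].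
have cis2pi : cis (pi *+ 2) = 0.
  by apply: S1_val_inj; rewrite cisE cos2pi sin_mulr2n sinpi mulr0 mul0rn.
(* The pullback along [cis] must kill the period, which makes its slope an integer. *)
have [k kE] : exists k : int, c * (pi *+ 2) = pi *+ 2 *~ k.
  by apply: cis_eq0; rewrite -cE /= cis2pi raddf0.
have ck : c = k%:~R.
  have pi2 : pi *+ 2 != 0 :> R by rewrite mulrn_eq0 /= gt_eqF ?pi_gt0.
  by apply: (mulIf pi2); rewrite kE mulrzl.
exists k => z; have [t _ <-] := cis_surj z.
by have /= -> := cE t; rewrite ck mulrzl raddfMz.
Qed.

End circle.

(** * Continuous characters of the torus and the counit *)

Section torus_kan.
Variable R : realType.

Local Notation K := (S1 R).
Local Notation T := (S1xS1 R).
Local Notation DD := (functor_comp (Ab_dual K) (functor_op (Ab_dual K))).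
Local Notation U := (torus_forget R).

Definition torus_fst : {additive T -> K} := (fst : (K * K)%type -> K).
Definition torus_snd : {additive T -> K} := (snd : (K * K)%type -> K).

Lemma torus_fst_continuous : continuous torus_fst.
Proof. by move=> x; exact: (@cvg_fst _ _ (nbhs x.1) (nbhs x.2)). Qed.

Lemma torus_snd_continuous : continuous torus_snd.
Proof. by move=> x; exact: (@cvg_snd _ _ (nbhs x.1) (nbhs x.2)). Qed.

Section torus_pair.
Variables (A : zmodType) (f g : {additive A -> K}).

Definition torus_pair_fun (x : A) : T := (f x, g x).

Fact torus_pair_is_zmod_morphism : zmod_morphism torus_pair_fun.
Proof. by move=> x y; rewrite /torus_pair_fun (raddfB f) (raddfB g). Qed.

HB.instance Definition _ :=
  GRing.isZmodMorphism.Build A T torus_pair_fun torus_pair_is_zmod_morphism.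

Definition torus_pair : {additive A -> T} := torus_pair_fun.

End torus_pair.

Lemma torus_pair_continuous (B : chab) (f g : {additive B -> K}) :
  continuous f -> continuous g -> continuous (torus_pair f g).
Proof.
move=> fc gc x.
by apply: (@cvg_pair _ _ _ (nbhs x) (nbhs (f x)) (nbhs (g x)));
  [exact: fc | exact: gc].
Qed.

(** The exponents come from restricting [f] to the two coordinate circles, whose sum is the
    torus. *)
Lemma continuous_torus_character (f : {additive T -> K}) : continuous f ->
  exists a b : int, forall p : T, f p = torus_fst p *~ a + torus_snd p *~ b.
Proof.
move=> fc.
pose z0 : {additive K -> K} := \0.
pose inl : {additive K -> T} := torus_pair idfun z0.
pose inr : {additive K -> T} := torus_pair z0 idfun.
have z0c : continuous z0 by move=> x; exact: (@cst_continuous K K 0).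
have idKc : continuous (idfun : {additive K -> K}) by move=> x A xA; exact: xA.
pose S1chab := CHAbGroup (@S1_compact R) (@S1_hausdorff R).
have inlc : continuous inl by exact: (@torus_pair_continuous S1chab).
have inrc : continuous inr by exact: (@torus_pair_continuous S1chab).
have [|a aE] := @continuous_S1_endo R (f \o inl : {additive K -> K}).
  by move=> x; apply: continuous_comp; [exact: inlc | exact: fc].
have [|b bE] := @continuous_S1_endo R (f \o inr : {additive K -> K}).
  by move=> x; apply: continuous_comp; [exact: inrc | exact: fc].
exists a, b => -[x y].
have -> : (x, y) = inl x + inr y :> T.
  by apply/eqP; rewrite /eq_op /= addr0 add0r !eqxx.
by rewrite raddfD /=; move: (aE x) (bE y) => /= -> ->; rewrite addr0 add0r.
Qed.

Definition torus_eval : {additive Ab_hom (Ab_hom T K) K -> T} :=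
  torus_pair (Ab_eval_at (torus_fst : Ab_hom T K) : {additive _ -> _})
    (Ab_eval_at (torus_snd : Ab_hom T K) : {additive _ -> _}).

(** Although [psi] is an arbitrary additive map, it respects integer combinations, and [f] is one of
    the two projections. *)
Lemma torus_eval_character (f : {additive T -> K})
    (psi : Ab_hom (Ab_hom T K) K) :
  continuous f ->
  (psi : {additive _ -> _}) (f : Ab_hom T K) = f (torus_eval psi).
Proof.
move=> /continuous_torus_character[a [b fE]]; rewrite fE.
have -> : (f : Ab_hom T K) =
    (torus_fst : Ab_hom T K) *~ a + (torus_snd : Ab_hom T K) *~ b.
  apply: additiveP => p; apply: etrans (fE p) _.
  pose ev := Ab_eval_at p : {additive Ab_hom T K -> K}.
  by rewrite -[RHS]/(ev _) raddfD !raddfMz.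
by rewrite raddfD !raddfMz.
Qed.

(** An object of the subcategory is only propositionally equal to the torus, so the evaluation is
    transported along that equality. *)
Definition torus_counit_comp (c : torus_category R) : mor (DD (U c)) (U c) :=
  match esym (proj2_sig c) in _ = A
    return {additive Ab_hom (Ab_hom A K) K -> A} with
  | erefl => torus_eval
  end.

Fact torus_counit_natural (a b : torus_category R) (f : mor a b) :
  torus_counit_comp b \c fmor (functor_comp DD U) f =
  fmor U f \c torus_counit_comp a.
Proof.
case: a b f => [A eA] [B eB]; subst A B => f.
apply: additiveP => psi /=.
have fc : continuous (f : chab_hom (torus R) (torus R)).
  exact: chab_continuous.
have fstc : continuous (torus_fst \o f : {additive T -> K}).
  by move=> x; apply: continuous_comp; [exact: fc | exact: torus_fst_continuous].
have sndc : continuous (torus_snd \o f : {additive T -> K}).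
  by move=> x; apply: continuous_comp; [exact: fc | exact: torus_snd_continuous].
rewrite [RHS]surjective_pairing.
(* Each coordinate of [f] is a continuous character of the torus. *)
exact: (congr2 pair (torus_eval_character psi fstc)
  (torus_eval_character psi sndc)).
Qed.

Definition torus_counit : nat_trans (functor_comp DD U) U :=
  NatTrans torus_counit_natural.

Definition torus_ob : torus_category R := exist _ (torus R) erefl.

(** * The universal property of the counit *)

Section lift.
Variables (G : functor Ab Ab) (alpha : nat_trans (functor_comp G U) U).

Let alphaT : {additive G T -> T} := alpha torus_ob.

Lemma alpha_endo (f g : {additive T -> K}) (x : G T) :
  continuous f -> continuous g ->
  alphaT ((fmor G (torus_pair f g : @mor Ab T T) : {additive _ -> _}) x) =
  torus_pair f g (alphaT x).
Proof.
move=> fc gc.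
pose e : @mor (torus_category R) torus_ob torus_ob :=
  @CHAbHom (torus R) (torus R) (torus_pair f g)
    (@torus_pair_continuous (torus R) f g fc gc).
exact: (congr1 (fun h : {additive G T -> T} => h x) (natural alpha e)).
Qed.

Let Gmor (A B : zmodType) (h : {additive A -> B}) : {additive G A -> G B} :=
  fmor G (h : @mor Ab A B).

Let GmorM (A B C : zmodType) (h : {additive B -> C}) (k : {additive A -> B}) x :
  Gmor (h \o k : {additive A -> C}) x = Gmor h (Gmor k x).
Proof.
exact: (congr1 (fun u : {additive G A -> G C} => u x)
  (@fmorM _ _ G A B C (h : @mor Ab B C) (k : @mor Ab A B))).
Qed.

Let zeroK (A : zmodType) : {additive A -> K} := \0.

Definition lift_at (A : zmodType) (x : G A) (f : Ab_hom A K) : K :=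
  torus_fst (alphaT (Gmor (torus_pair f (zeroK A)) x)).

(** Pairing the composite with zero factors as the endomorphism [torus_pair u (zeroK T)] after
    [torus_pair f g], and [alphaT] commutes with that endomorphism. *)
Lemma lift_at_pair (A : zmodType) (x : G A) (f g : {additive A -> K})
    (u : {additive T -> K}) : continuous u ->
  lift_at x (u \o torus_pair f g : {additive A -> K}) =
  u (alphaT (Gmor (torus_pair f g) x)).
Proof.
move=> uc; have zc : continuous (zeroK T).
  by move=> p; exact: (@cst_continuous T K 0).
rewrite /lift_at; have -> : torus_pair (u \o torus_pair f g) (zeroK A) =
    (torus_pair u (zeroK T) \o torus_pair f g : {additive A -> T}).
  exact: additiveP.
by rewrite GmorM (alpha_endo _ uc zc).
Qed.

Lemma lift_at_dual (A B : zmodType) (h : {additive A -> B}) (x : G A)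
    (f : {additive B -> K}) :
  lift_at (Gmor h x) f = lift_at x (f \o h : {additive A -> K}).
Proof.
rewrite /lift_at -GmorM.
apply: (congr1 (fun k : {additive A -> T} => torus_fst (alphaT (Gmor k x)))).
exact: additiveP.
Qed.

Fact lift_at_is_zmod_morphism (A : zmodType) (x : G A) :
  zmod_morphism (lift_at x).
Proof.
move=> f g.
have subc : continuous (torus_fst \- torus_snd : T -> K).
  move=> p; apply: (@continuous_comp _ _ _ (torus_pair torus_fst torus_snd)
    (fun p : K * K => p.1 - p.2)); last exact: sub_continuous.
  exact: (@torus_pair_continuous (torus R) _ _
    torus_fst_continuous torus_snd_continuous).
(* The difference and the two projections are evaluated at one and the same point of the torus, so
   the value at [f - g] is the difference of the values. *)
have := @lift_at_pair A x f g _ subc.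
have := @lift_at_pair A x f g _ torus_fst_continuous.
have := @lift_at_pair A x f g _ torus_snd_continuous.
have -> : (torus_fst \o torus_pair f g : {additive A -> K}) = f.
  exact: additiveP.
have -> : (torus_snd \o torus_pair f g : {additive A -> K}) = g.
  exact: additiveP.
have -> : ((torus_fst \- torus_snd) \o torus_pair f g : {additive A -> K}) =
    (f - g)%R.
  exact: additiveP.
by move=> -> -> ->.
Qed.

HB.instance Definition _ (A : zmodType) (x : G A) :=
  GRing.isZmodMorphism.Build (Ab_hom A K) K (lift_at x)
    (lift_at_is_zmod_morphism x).

Definition lift_comp (A : zmodType) (x : G A) : Ab_hom (Ab_hom A K) K :=
  lift_at x : {additive Ab_hom A K -> K}.

Fact lift_comp_is_zmod_morphism (A : zmodType) : zmod_morphism (@lift_comp A).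
Proof.
by move=> x y; apply: additiveP => f;
  rewrite /= /lift_at (raddfB (Gmor _)) !raddfB.
Qed.

HB.instance Definition _ (A : zmodType) :=
  GRing.isZmodMorphism.Build (G A) (Ab_hom (Ab_hom A K) K) (@lift_comp A)
    (@lift_comp_is_zmod_morphism A).

Definition lift_mor (A : zmodType) : @mor Ab (G A) (DD A) :=
  @lift_comp A : {additive G A -> Ab_hom (Ab_hom A K) K}.

Fact lift_natural (A B : Ab) (h : mor A B) :
  lift_mor B \c fmor G h = fmor DD h \c lift_mor A.
Proof.
by apply: additiveP => x; apply: additiveP => f; exact: (lift_at_dual h x f).
Qed.

Definition lift : nat_trans G DD := @NatTrans Ab Ab G DD lift_mor lift_natural.

Lemma lift_counit c : torus_counit c \c lift (U c) = alpha c.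
Proof.
case: c => A eA; subst A; apply: additiveP => x.
(* For the identity pair, [lift_at_pair] reads off the two coordinates of [alphaT x]. *)
have pairE : torus_pair torus_fst torus_snd = idfun :> {additive T -> T}.
  by apply: additiveP => -[].
have Gid : Gmor (torus_pair torus_fst torus_snd) x = x.
  rewrite pairE; exact: (congr1 (fun u : {additive G T -> G T} => u x)
    (@fmor1 _ _ G (T : Ab))).
have := @lift_at_pair _ x torus_fst torus_snd _ torus_fst_continuous.
have := @lift_at_pair _ x torus_fst torus_snd _ torus_snd_continuous.
rewrite Gid pairE => sndE fstE; apply: etrans _ (esym (surjective_pairing _)).
apply: (congr2 pair); [apply: etrans fstE | apply: etrans sndE].
  by congr lift_at; exact: additiveP.
by congr lift_at; exact: additiveP.
Qed.

(** Every character [f] is the first projection after [torus_pair f (zeroK A)]. Naturality of [s]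
    along this map reduces the claim to the torus, where the counit determines the needed value. *)
Lemma lift_uniq (s : nat_trans G DD) :
  (forall c, torus_counit c \c s (U c) = alpha c) -> lift = s.
Proof.
move=> sE; apply: nat_transP => A; apply: additiveP => x; apply: additiveP => f.
pose h := torus_pair f (zeroK A).
have sT y : torus_eval ((s (T : Ab) : {additive _ -> _}) y) = alphaT y.
  exact: (congr1 (fun u : {additive G T -> T} => u y) (sE torus_ob)).
rewrite -[LHS]/(torus_fst (alphaT (Gmor h x))) -sT.
have := congr1 (fun u : {additive G A -> Ab_hom (Ab_hom T K) K} => u x)
  (natural s (h : @mor Ab A T)).
rewrite /= => ->.
by congr (((s A : {additive _ -> _}) x : {additive _ -> _}) _); exact: additiveP.
Qed.

End lift.

Fact torus_ranP : is_right_kan_extension torus_counit.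
Proof.
move=> G alpha; exists (lift alpha); split; first exact: lift_counit.
exact: lift_uniq.
Qed.

(** * Agreement of the two monad structures *)

Definition torus_ran : ran U U := Ran torus_ranP.

(** The Kan extension is carried by the double dual functor itself, so the units can be compared by
    an equation, tested after the counit. *)
Lemma torus_ran_unit :
  munit (double_dualization_monad K) = codensity_unit torus_ran.
Proof.
apply: (@ran_ext _ _ _ U U torus_ran) => c; rewrite codensity_unitE.
by case: c => A eA; subst A; apply: additiveP => -[].
Qed.

(** Evaluation at a projection is that projection after [torus_eval], so [Phi] receives the same two
    arguments on both sides. *)
Lemma torus_eval_mult (Phi : Ab_hom (Ab_hom (Ab_hom (Ab_hom T K) K) K) K) :
  torus_eval (Ab_precomp (@Ab_eval K (Ab_hom T K) : {additive _ -> _}) Phi) =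
  torus_eval
    (Ab_precomp (Ab_precomp torus_eval : {additive Ab_hom T K -> _}) Phi).
Proof.
have fstE : @Ab_eval K _ (torus_fst : Ab_hom T K) =
    Ab_precomp torus_eval torus_fst.
  exact: additiveP.
have sndE : @Ab_eval K _ (torus_snd : Ab_hom T K) =
    Ab_precomp torus_eval torus_snd.
  exact: additiveP.
pose phi : Ab_hom (Ab_hom (Ab_hom T K) K) K -> K := Phi : {additive _ -> _}.
exact: (congr2 (fun u v => (phi u, phi v) : T) fstE sndE).
Qed.

Lemma torus_ran_mult :
  mmult (double_dualization_monad K) = codensity_mult torus_ran.
Proof.
apply: (@ran_ext _ _ _ U U torus_ran) => c.
apply: etrans _ (esym (codensity_multE torus_ran c)).
case: c => A eA; subst A; apply: additiveP => Phi.
exact: (torus_eval_mult Phi).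
Qed.

End torus_kan.

(** The proofs of the monad laws may differ, but the identity transformation is an isomorphism in
    both directions. *)
Lemma monads_isomorphic_same_functor (C : category) (T : functor C C)
    u m l r a u' m' l' r' a' : u = u' -> m = m' ->
  monads_isomorphic (@Monad C T u m l r a) (@Monad C T u' m' l' r' a').
Proof.
move=> uE mE; subst u' m'.
have idN A B (f : mor A B) : idc (T B) \c fmor T f = fmor T f \c idc (T A).
  by rewrite comp1c compc1.
pose I : nat_trans T T := NatTrans idN.
exists I, I; split=> [||A|A]; try exact: comp1c.
  by split=> A /=; rewrite ?fmor1 !comp1c ?compc1.
by split=> A /=; rewrite ?fmor1 !comp1c ?compc1.
Qed.

Theorem theorem4p6 (R : realType) :
  is_codensity_monad (double_dualization_monad (S1 R)) (torus_forget R).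
Proof.
exists (torus_ran R); apply: monads_isomorphic_same_functor.
  exact: torus_ran_unit.
exact: torus_ran_mult.
Qed.
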